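(* Let $G$ be a finite simple graph on the vertex set $\{1,\dots,d\}$. Then the edge polytope $\mathcal{P}_G$ of $G$ satisfies condition (E).
   Context: Edge polytope: $\mathcal{P}_G=\mathrm{conv}\{\mathbf{e}_i+\mathbf{e}_j : \{i,j\}\in E(G)\}\subset\mathbb{R}^d$, with $\mathbf{e}_i$ the unit coordinate vectors. A polytope $P$ with all vertices in $\{0,1\}^d$ satisfies condition (E) if: two distinct vertices $\mathbf{a}$ and $\mathbf{b}$ of $P$ form an edge of $P$ (i.e. $\mathrm{conv}(\{\mathbf{a},\mathbf{b}\})$ is an edge) if and only if there exists a unique way (up to order) to write $\mathbf{a}+\mathbf{b}$ as the sum of two (not necessarily distinct) vertices of $P$. *)

(* Defs.v *)
From HB Require Import structures.
From mathcomp Require Import all_boot all_order all_algebra.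
From mathcomp Require Import classical_sets reals convex.

Set Implicit Arguments.
Unset Strict Implicit.
Unset Printing Implicit Defensive.

Import Order.TTheory GRing.Theory Num.Theory.

Local Open Scope classical_set_scope.
Local Open Scope ring_scope.

(* [convex_lmodType V] is [V] itself, seen as a convex space. *)
Definition convex_hull (R : realType) (V : lmodType R) (A : set V) : set V :=
  smallest (fun B : set (convex_lmodType V) => convex_set B) A.

Definition affine_set (R : realType) (V : lmodType R) (A : set V) : Prop :=
  forall (x y : V) (t : R), A x -> A y -> A (t *: x + (1 - t) *: y).

Definition affine_hull (R : realType) (V : lmodType R) (A : set V) : set V :=
  smallest (fun B : set V => affine_set B) A.

(* The empty set has no dimension. *)
Definition has_dim (R : realType) (d : nat) (F : set 'rV[R]_d) (k : nat) :
    Prop :=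
  exists (x : 'rV[R]_d) (U : {vspace 'rV[R]_d}),
    affine_hull F = [set y | y - x \in U] /\ \dim U = k.

Definition is_polytope (R : realType) (d : nat) (P : set 'rV[R]_d) : Prop :=
  exists s : seq 'rV[R]_d, P = convex_hull [set x | x \in s].

Definition dotprod (R : realType) (d : nat) (c x : 'rV[R]_d) : R :=
  \sum_(i < d) c 0 i * x 0 i.

(* The improper faces are included: c = 0 gives P for b = 0 and the empty set
   for b = 1. *)
Definition is_face (R : realType) (d : nat) (P F : set 'rV[R]_d) : Prop :=
  exists (c : 'rV[R]_d) (b : R),
    (forall x, P x -> dotprod c x <= b) /\
    F = P `&` [set x | dotprod c x = b].

Definition is_vertex (R : realType) (d : nat) (P : set 'rV[R]_d)
    (v : 'rV[R]_d) : Prop :=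
  is_face P [set v].

Definition is_edge (R : realType) (d : nat) (P F : set 'rV[R]_d) : Prop :=
  is_face P F /\ has_dim F 1.

Definition zero_one_polytope (R : realType) (d : nat) (P : set 'rV[R]_d) :
    Prop :=
  is_polytope P /\
  forall (v : 'rV[R]_d), is_vertex P v -> forall i, v 0 i = 0 \/ v 0 i = 1.

Definition unique_vertex_sum (R : realType) (d : nat) (P : set 'rV[R]_d)
    (s : 'rV[R]_d) : Prop :=
  exists u v : 'rV[R]_d,
    [/\ is_vertex P u, is_vertex P v, u + v = s &
      forall u' v' : 'rV[R]_d, is_vertex P u' -> is_vertex P v' ->
        u' + v' = s -> (u' = u /\ v' = v) \/ (u' = v /\ v' = u)].

(* Condition (E) is only defined for polytopes with 0/1 vertices, so that
   requirement is part of the condition. *)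
Definition condition_E (R : realType) (d : nat) (P : set 'rV[R]_d) : Prop :=
  zero_one_polytope P /\
  forall a b : 'rV[R]_d, is_vertex P a -> is_vertex P b -> a <> b ->
    (is_edge P (convex_hull [set a; b]) <-> unique_vertex_sum P (a + b)).

Definition unit_vec (R : realType) (d : nat) (i : 'I_d) : 'rV[R]_d :=
  delta_mx 0 i.

(* A graph on the d vertices is given by its adjacency relation e. *)
Definition edge_polytope (R : realType) (d : nat) (e : rel 'I_d) :
    set 'rV[R]_d :=
  convex_hull
    [set x | exists i j : 'I_d, e i j /\ x = unit_vec R i + unit_vec R j].

Arguments edge_polytope R {d} e.

(* Main.v *)
Require Import Defs.
From mathcomp Require Import all_boot all_order all_algebra.
From mathcomp Require Import classical_sets reals convex.
From mathcomp Require Import interval_inference lra.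

(** The generators e_i + e_j of the edge polytope are exactly its vertices.

    If conv(a, b) is a face, say the set where a functional c attains its
    maximum m, and u + v = a + b with u, v vertices, then c u + c v = 2 m forces
    u and v onto the face; a vertex of P lying in conv(a, b) is a or b, and
    u = v = a would give a = b.  This direction holds for every polytope
    ([face_unique_vertex_sum]).

    Conversely, a functional with natural coefficients is a weighting w of the
    vertices of the graph, and it exposes conv(a, b) as soon as a and b are the
    two edges of maximal total weight.  If a = ij and b = il share the vertex i,
    give i weight 2, give j and l weight 1, and every other vertex weight 0
    ([adjacent_edges_face]).  If a = ij and b = kl are disjoint, uniqueness of
    a + b says that neither of the other two perfect matchings {ik, jl} and
    {il, jk} of {i, j, k, l} is contained in G.  Two non-edges, one from each
    matching, always share a vertex; giving that vertex weight 3, its partner in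
    a or b weight 1, and the two remaining vertices weight 2 puts weight 4 on a
    and b and at least 4 on no other pair than the two non-edges
    ([disjoint_edges_face]). *)

Set Implicit Arguments.
Unset Strict Implicit.
Unset Printing Implicit Defensive.

Import Order.TTheory GRing.Theory Num.Theory.

Local Open Scope classical_set_scope.
Local Open Scope ring_scope.

(** * Convex hulls and their faces *)

Section Hull.
Variables (R : realType).

Lemma hull_convex (V : lmodType R) (A : set V) :
  convex_set (convex_hull A : set (convex_lmodType V)).
Proof.
move=> x y k /set_mem Hx /set_mem Hy; apply/mem_set => B [cB sAB].
by apply/set_mem/cB; apply/mem_set; [apply: Hx | apply: Hy].
Qed.

Lemma subsingleton_convex (V : lmodType R) (A : set V) (v : V) :
  A `<=` [set v] -> convex_set (A : set (convex_lmodType V)).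
Proof.
move=> Av x y k Ax Ay.
by rewrite (Av _ (set_mem Ay)) (Av _ (set_mem Ax)) convmm -(Av _ (set_mem Ax)).
Qed.

Variable (d : nat).
Implicit Types (A P F : set 'rV[R]_d) (a b c u v x y : 'rV[R]_d).

Lemma dotprodD c x y : dotprod c (x + y) = dotprod c x + dotprod c y.
Proof.
by rewrite -big_split; apply: eq_bigr => i _; rewrite mxE mulrDr.
Qed.

Lemma dotprodZ c (t : R) x : dotprod c (t *: x) = t * dotprod c x.
Proof.
by rewrite /dotprod mulr_sumr; apply: eq_bigr => i _; rewrite mxE mulrCA.
Qed.

Lemma dotprod_conv c x y (k : {i01 R}) :
  dotprod c (conv k (x : convex_lmodType 'rV[R]_d) y) =
  k%:num * dotprod c x + (1 - k%:num) * dotprod c y.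
Proof. by rewrite /conv /= dotprodD !dotprodZ. Qed.

(** A point of the hull where c reaches its bound can only be a combination of
    generators where c reaches it.  Rather than handling such combinations, one
    checks that the points satisfying both claims form a convex set. *)
Lemma hull_supporting A c (m : R) x : (forall y, A y -> dotprod c y <= m) ->
  convex_hull A x -> dotprod c x <= m /\
    (dotprod c x = m -> convex_hull (A `&` [set y | dotprod c y = m]) x).
Proof.
move=> leA; pose B := [set x | dotprod c x <= m /\ (dotprod c x = m ->
  convex_hull (A `&` [set y | dotprod c y = m]) x)].
suff cB : convex_set (B : set (convex_lmodType _)).
  move: x; apply: (smallest_sub cB) => y Ay.
  by split=> [|cy]; [exact: leA | apply: sub_gen_smallest].
apply/convex_setW => y z /set_mem[ley By] /set_mem[lez Bz] k k0 k1.
apply/mem_set; split; rewrite dotprod_conv; first by nra.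
move=> eqm; have ym : dotprod c y = m by nra.
have zm : dotprod c z = m by nra.
by apply/set_mem/hull_convex; apply/mem_set; [apply: By | apply: Bz].
Qed.

Lemma hull_is_face A c (m : R) : (forall y, A y -> dotprod c y <= m) ->
  is_face (convex_hull A) (convex_hull (A `&` [set y | dotprod c y = m])).
Proof.
move=> leA; exists c, m; split=> [x /(hull_supporting leA)[]//|].
apply/seteqP; split=> [|x [/(hull_supporting leA)[_ H] /H//]].
have cI : convex_set (convex_hull A `&` [set y | dotprod c y = m]
                      : set (convex_lmodType _)).
  move=> y z k /set_mem[Ay ym] /set_mem[Az zm]; apply/mem_set; split.
    by apply/set_mem/hull_convex; apply/mem_set.
  by rewrite /mkset dotprod_conv ym zm; lra.
by apply: (smallest_sub cI) => y [Ay ym]; split=> //; apply: sub_gen_smallest.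
Qed.

Lemma vertex_mem P v : is_vertex P v -> P v.
Proof.
move=> [c [m [_ faceE]]].
by have [] : (P `&` [set x | dotprod c x = m]) v by rewrite -faceE.
Qed.

(** The functional exposing v attains its bound on A only at v, so v is a
    combination of the points of A equal to v; if there were none, the hull
    would be empty. *)
Lemma vertex_mem_generators P A v :
  is_vertex P v -> A `<=` P -> convex_hull A v -> A v.
Proof.
move=> [c [m [leP faceE]]] sAP Av.
have [Pv vm] : (P `&` [set x | dotprod c x = m]) v by rewrite -faceE.
have [_ /(_ vm)] := hull_supporting (fun y Ay => leP y (sAP y Ay)) Av.
have cI : convex_set (A `&` [set v] : set (convex_lmodType _)).
  by apply: (@subsingleton_convex _ _ v) => x [].
have sub : A `&` [set y | dotprod c y = m] `<=` A `&` [set v].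
  by move=> x [Ax xm]; split=> //; rewrite faceE; split=> //; apply: sAP.
by move=> /(smallest_sub cI sub)[].
Qed.

(** A functional c exposing conv(a, b) with maximum m gives c u + c v = 2 m for
    every other decomposition u + v, which forces u and v onto the face. *)
Lemma face_unique_vertex_sum P a b : is_vertex P a -> is_vertex P b -> a <> b ->
  is_face P (convex_hull [set a; b]) -> unique_vertex_sum P (a + b).
Proof.
move=> Va Vb neq_ab [c [m [leP faceE]]].
have sub : [set a; b] `<=` P `&` [set x | dotprod c x = m].
  by rewrite -faceE; exact: sub_gen_smallest.
have [_ am] := sub a (or_introl erefl); have [_ bm] := sub b (or_intror erefl).
have on_face u v : is_vertex P u -> is_vertex P v -> u + v = a + b ->
    u = a \/ u = b.
  move=> Vu Vv uv; apply: (vertex_mem_generators (A := [set a; b]) Vu).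
    by move=> x /sub[].
  have := congr1 (dotprod c) uv; rewrite !dotprodD am bm => sumE.
  rewrite faceE; split; first exact: vertex_mem Vu.
  rewrite /mkset.
  by have := leP u (vertex_mem Vu); have := leP v (vertex_mem Vv); lra.
exists a, b; split=> // u v Vu Vv uv; case: (on_face u v Vu Vv uv) => uE.
  by left; split=> //; apply: (@addrI _ a); rewrite -uv uE.
by right; split=> //; apply: (@addrI _ b); rewrite -{1}uE uv addrC.
Qed.

Lemma segment_dim a b : a <> b -> has_dim (convex_hull [set a; b]) 1.
Proof.
move=> neq_ab; exists a, <[b - a]>%VS; split; last first.
  by rewrite dim_vline subr_eq0 eq_sym; case: eqP.
pose L := [set y | y - a \in <[b - a]>%VS].
have aL : affine_set L.
  move=> x y t Lx Ly; rewrite /L /mkset.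
  have -> : t *: x + (1 - t) *: y - a = t *: (x - a) + (1 - t) *: (y - a).
    by apply/matrixP => i j; rewrite !mxE; lra.
  by rewrite memvD // memvZ.
have cL : convex_set (L : set (convex_lmodType _)).
  by move=> x y k /set_mem Lx /set_mem Ly; apply/mem_set; exact: aL.
apply/seteqP; split.
  apply: (smallest_sub aL); apply: (smallest_sub cL) => x [->|->].
    by rewrite /L /mkset subrr mem0v.
  exact: memv_line.
move=> y /vlineP[t yE] B [aB sB].
have -> : y = t *: b + (1 - t) *: a.
  apply/matrixP => i j; have := congr1 (fun M : 'rV_d => M i j) yE.
  by rewrite !mxE; lra.
by apply: aB; apply/sB; apply: sub_gen_smallest; [right | left].
Qed.

End Hull.

(** * Faces cut out by weights on the graph *)

Section EdgePolytope.
Variables (R : realType) (d : nat) (e : rel 'I_d).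
Hypotheses (e_sym : symmetric e) (e_irr : irreflexive e).
Implicit Types (i j k l p q : 'I_d) (w : 'I_d -> nat).

Local Notation edge_vec i j := (unit_vec R i + unit_vec R j).

Lemma edge_vecE i j k : edge_vec i j 0 k = ((k == i) + (k == j))%:R.
Proof. by rewrite !mxE natrD. Qed.

Lemma mem_edge_vec i j k l : edge_vec i j = edge_vec k l -> i = k \/ i = l.
Proof.
move=> /(congr1 (fun x : 'rV_d => x 0 i)); rewrite !edge_vecE => /eqP.
rewrite eqr_nat eqxx.
by have [|_] := eqVneq i k; [left | have [|_] := eqVneq i l; [right |]].
Qed.

Lemma dotprod_weight w i j :
  dotprod (\row_k (w k)%:R) (edge_vec i j) = (w i + w j)%:R :> R.
Proof.
have unitE p : dotprod (\row_k (w k)%:R) (unit_vec R p) = (w p)%:R.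
  rewrite /dotprod (bigD1 p) //= big1 ?addr0 => [|q /negPf qp].
    by rewrite !mxE !eqxx mulr1.
  by rewrite !mxE qp andbF mulr0.
by rewrite dotprodD !unitE natrD.
Qed.

(** A weighting of the graph is a functional, whose value at an edge vector is
    the total weight of the edge.  Natural weights reduce the search for a
    supporting functional to a finite case check. *)
Lemma weight_face w (m : nat) i j k l : e i j -> e k l ->
    (forall p q, e p q -> (w p + w q <= m)%N /\ ((w p + w q)%N = m ->
       edge_vec p q = edge_vec i j \/ edge_vec p q = edge_vec k l)) ->
    (w i + w j)%N = m -> (w k + w l)%N = m ->
  is_face (edge_polytope R e) (convex_hull [set edge_vec i j; edge_vec k l]).
Proof.
move=> eij ekl max_w wij wkl.
set A := [set x | exists p q, e p q /\ x = edge_vec p q].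
have leA x : A x -> dotprod (\row_p (w p)%:R) x <= m%:R.
  by move=> [p [q [/max_w[le_m _] ->]]]; rewrite dotprod_weight ler_nat.
have -> : [set edge_vec i j; edge_vec k l] =
    A `&` [set x | dotprod (\row_p (w p)%:R) x = m%:R].
  apply/seteqP; split=> [x [->|->]|x [[p [q [/max_w[_ H] ->]]]]].
  - by split; [exists i, j | rewrite /mkset dotprod_weight wij].
  - by split; [exists k, l | rewrite /mkset dotprod_weight wkl].
  by rewrite /mkset dotprod_weight => /eqP; rewrite eqr_nat => /eqP /H.
exact: hull_is_face leA.
Qed.

Lemma edge_vec_vertex i j : e i j ->
  is_vertex (edge_polytope R e) (edge_vec i j).
Proof.
move=> eij; have neq_ij : i != j by apply: contraTneq eij => ->; rewrite e_irr.
(* A vertex is the degenerate case a = b of a face conv(a, b). *)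
rewrite /is_vertex.
have -> : [set edge_vec i j] = convex_hull [set edge_vec i j; edge_vec i j].
  rewrite setUid /convex_hull smallest_id //.
  exact: (@subsingleton_convex _ _ _ (edge_vec i j)).
apply: (@weight_face (fun p => if p == i then 1 else if p == j then 1 else 0)%N
  2) => // [p q||]; last 2 first.
- by rewrite !eqxx eq_sym (negPf neq_ij).
- by rewrite !eqxx eq_sym (negPf neq_ij).
do ![case: eqP => [->|_] /=]; rewrite ?e_irr //; split=> // _; left=> //.
by rewrite addrC.
Qed.

Lemma vertex_edge_vec v : is_vertex (edge_polytope R e) v ->
  exists i j, e i j /\ v = edge_vec i j.
Proof.
move=> Vv; set A := [set x | exists i j, e i j /\ x = edge_vec i j].
apply: (vertex_mem_generators (A := A) Vv); first exact: sub_gen_smallest.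
exact: vertex_mem Vv.
Qed.

(** Two edges with a common vertex always span a face, whether or not jl is an
    edge: the weights 2, 1, 1 of i, j, l give jl only weight 2 < 3. *)
Lemma adjacent_edges_face i j l : e i j -> e i l -> j != l ->
  is_face (edge_polytope R e) (convex_hull [set edge_vec i j; edge_vec i l]).
Proof.
move=> eij eil neq_jl.
have neq_ji : j != i by apply: contraTneq eij => ->; rewrite e_irr.
have neq_li : l != i by apply: contraTneq eil => ->; rewrite e_irr.
apply: (@weight_face (fun p => if p == i then 2 else
    if p == j then 1 else if p == l then 1 else 0)%N 3) => // [p q||].
- do ![case: eqP => [->|_] /=]; rewrite ?e_irr //; split=> // _.
  all: try by [left | right | left; rewrite addrC | right; rewrite addrC].
- by rewrite !eqxx (negPf neq_ji).
- by rewrite !eqxx (negPf neq_li) (eq_sym l) (negPf neq_jl).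
Qed.

(** This is the case where the two non-edges meet in i.  Being the
    heaviest vertex, i makes ik and il too heavy, which is harmless, and its
    partner j of weight 1 keeps jk and jl below 4, whether or not they are
    edges. *)
Lemma disjoint_edges_face i j k l : e i j -> e k l -> uniq [:: i; j; k; l] ->
    ~~ e i k -> ~~ e i l ->
  is_face (edge_polytope R e) (convex_hull [set edge_vec i j; edge_vec k l]).
Proof.
move=> eij ekl.
rewrite /= !inE !negb_or => /and4P[/and3P[ij ik il] /andP[jk jl] kl _].
move=> /negPf nik /negPf nil.
apply: (@weight_face (fun p => if p == i then 3 else if p == j then 1 else
    if p == k then 2 else if p == l then 2 else 0)%N 4) => // [p q||].
- do ![case: eqP => [->|_] /=];
    rewrite ?e_irr ?nik ?nil 1?e_sym ?nik ?nil //; split=> // _.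
  all: try by [left | right | left; rewrite addrC | right; rewrite addrC].
- by rewrite !eqxx (eq_sym j) (negPf ij).
- rewrite !(eq_sym k) !(eq_sym l) eqxx (negPf ik) (negPf il) (negPf jk).
  by rewrite (negPf jl) (negPf kl) eqxx.
Qed.

(** Among the decompositions of ij + kl into two edges, only ik + jl and il + jk
    could break the last hypothesis, and excluding them produces the non-edges
    that the supporting weights need. *)
Lemma unique_sum_edges_face i j k l : e i j -> e k l ->
    edge_vec i j <> edge_vec k l ->
    (forall p q r s, e p q -> e r s ->
       edge_vec p q + edge_vec r s = edge_vec i j + edge_vec k l ->
       edge_vec p q = edge_vec i j \/ edge_vec p q = edge_vec k l) ->
  is_face (edge_polytope R e) (convex_hull [set edge_vec i j; edge_vec k l]).
Proof.
move=> eij ekl neq_ab uniq_ab.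
have eji : e j i by rewrite e_sym.
have elk : e l k by rewrite e_sym.
have [ik|ik] := eqVneq i k.
  subst k; apply: adjacent_edges_face => //.
  by apply/eqP => eq_ab; apply: neq_ab; rewrite eq_ab.
have [il|il] := eqVneq i l.
  subst l; rewrite [unit_vec R k + _]addrC; apply: adjacent_edges_face => //.
  by apply/eqP => eq_ab; apply: neq_ab; rewrite eq_ab addrC.
have [jk|jk] := eqVneq j k.
  by subst k; rewrite [unit_vec R i + _]addrC; apply: adjacent_edges_face.
have [jl|jl] := eqVneq j l.
  subst l; rewrite [unit_vec R i + _]addrC [unit_vec R k + _]addrC.
  exact: adjacent_edges_face.
have ij : i != j by apply: contraTneq eij => ->; rewrite e_irr.
have kl : k != l by apply: contraTneq ekl => ->; rewrite e_irr.
have not_ab p q : p \in [:: i; j] -> q \in [:: k; l] ->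
    edge_vec p q = edge_vec i j \/ edge_vec p q = edge_vec k l -> False.
  rewrite !inE => pij qkl [|/mem_edge_vec]; last first.
    by case: pij qkl => /orP[]/eqP-> _ []/eqP; apply/negP.
  rewrite [unit_vec R p + _]addrC => /mem_edge_vec.
  by case: qkl => /orP[]/eqP-> []/eqP; rewrite eq_sym; apply/negP.
have nik_jl : ~~ (e i k && e j l).
  apply/negP => /andP[eik ejl];
  apply: (not_ab i k); rewrite ?inE ?eqxx ?orbT //.
  by apply: (uniq_ab i k j l eik ejl); rewrite addrACA.
have nil_jk : ~~ (e i l && e j k).
  apply/negP => /andP[eil ejk];
  apply: (not_ab i l); rewrite ?inE ?eqxx ?orbT //.
  by apply: (uniq_ab i l j k eil ejk); rewrite addrACA [unit_vec R l + _]addrC.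
(* The two non-edges meet in i, k, l or j respectively; naming that vertex i
   reduces every case to the first. *)
case/nandP: nik_jl => [nik|njl]; case/nandP: nil_jk => [nil|njk].
- by apply: disjoint_edges_face; rewrite //= !inE !negb_or ij ik il jk jl kl.
- rewrite setUC [unit_vec R i + _]addrC.
  rewrite [unit_vec R j + _]addrC.
  apply: disjoint_edges_face; rewrite 1?e_sym //= !inE !negb_or.
  by rewrite kl ij ![k == _]eq_sym ![l == _]eq_sym ik il jk jl.
- rewrite setUC [unit_vec R k + _]addrC.
  apply: disjoint_edges_face; rewrite 1?e_sym //= !inE !negb_or.
  by rewrite [l == k]eq_sym kl ij ![k == _]eq_sym ![l == _]eq_sym ik il jk jl.
- rewrite [unit_vec R i + _]addrC; apply: disjoint_edges_face => //=.
  by rewrite !inE !negb_or [j == i]eq_sym ij ik il jk jl kl.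
Qed.

End EdgePolytope.

Theorem lemma3p9 (R : realType) (d : nat) (e : rel 'I_d)
    (e_sym : symmetric e) (e_irr : irreflexive e) :
  condition_E (edge_polytope R e).
Proof.
split; [split|].
- pose E := [pred p : 'I_d * 'I_d | e p.1 p.2].
  exists [seq unit_vec R p.1 + unit_vec R p.2 | p in E].
  congr (convex_hull _); apply/seteqP; split=> x.
    by move=> [i [j [eij ->]]];
      rewrite /mkset; apply/fintype.imageP; exists (i, j).
  by rewrite /mkset => /fintype.imageP[[i j] eij ->]; exists i, j.
- move=> v /vertex_edge_vec[i [j [eij ->]]] k; rewrite edge_vecE.
  have /negPf ij : i != j by apply: contraTneq eij => ->; rewrite e_irr.
  have [->|_] := eqVneq k i; first by rewrite ij; right.
  by have [_|_] := eqVneq k j; [right | left].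
move=> a b Va Vb neq_ab; split=> [[Fab _]|].
  exact: face_unique_vertex_sum.
move=> [u [v [_ _ _ uniq_uv]]]; split; last exact: segment_dim.
have uniq_ab x y : is_vertex (edge_polytope R e) x ->
    is_vertex (edge_polytope R e) y -> x + y = a + b -> x = a \/ x = b.
  move=> Vx Vy /(uniq_uv x y Vx Vy).
  by case: (uniq_uv a b Va Vb erefl) => -[-> ->] [[-> _]|[-> _]]; auto.
have [i [j [eij aE]]] := vertex_edge_vec Va.
have [k [l [ekl bE]]] := vertex_edge_vec Vb.
rewrite aE bE in neq_ab uniq_ab *; apply: unique_sum_edges_face => //.
by move=> p q r s epq ers; apply: uniq_ab; exact: edge_vec_vertex.
Qed.
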